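(* Let $q$ be a power of a prime $p\ge5$. Then $\Theta_{\rm c}=\emptyset$ if $q\equiv1\pmod 6$, and $\Theta_{\rm c}=\{27\}$ if $q\not\equiv1\pmod 6$.
   Context: $\mathbb F_q$ is the field with $q$ elements. Let $\Omega=\{(s,t)\in\mathbb F_q^2: t(1+s+t)\neq0\}$. For $(s,t)\in\Omega$ let $G_{s,t}(X)=X^4-2X^3-sX^2-2tX+t$ and $\theta(s,t)=\frac{s^3}{t(1+s+t)}$. Define $\Theta_{\rm c}=\{\theta(s,t):(s,t)\in\Omega,\ G_{s,t}\ \text{is the square of an irreducible quadratic over}\ \mathbb F_q\}$. *)

(* Defs.v *)
From HB Require Import structures.
From mathcomp Require Import all_boot all_order all_algebra.
From mathcomp Require Import all_classical.

Set Implicit Arguments.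
Unset Strict Implicit.
Unset Printing Implicit Defensive.

Import GRing.Theory.

Local Open Scope classical_set_scope.
Local Open Scope ring_scope.

Section Defs.
Variable F : finFieldType.

Definition Omega : set (F * F) :=
  [set st | st.2 * (1 + st.1 + st.2) != 0].

Definition Gpoly (s t : F) : {poly F} :=
  'X^4 - 2 *: 'X^3 - s *: 'X^2 - (2 * t) *: 'X + t%:P.

Definition theta (s t : F) : F := s ^+ 3 / (t * (1 + s + t)).

Definition square_of_irreducible_quadratic (g : {poly F}) : Prop :=
  exists h : {poly F}, [/\ size h = 3%N, irreducible_poly h & g = h ^+ 2].

Definition Theta_c : set F :=
  [set theta st.1 st.2 | st in
    [set st | Omega st /\ square_of_irreducible_quadratic (Gpoly st.1 st.2)]].

End Defs.

Arguments Omega F : clear implicits.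
Arguments Theta_c F : clear implicits.

(* Main.v *)
Require Import Defs.
From HB Require Import structures.
From mathcomp Require Import all_boot all_order all_algebra all_field.
From mathcomp Require Import all_classical.
From mathcomp Require Import ring zify.

Set Implicit Arguments.
Unset Strict Implicit.
Unset Printing Implicit Defensive.

Import GRing.Theory.

Local Open Scope classical_set_scope.
Local Open Scope ring_scope.

(** Comparing coefficients in G_{s,t} = h^2 forces t = 1, s = -3 and
    h = a (X^2 - X + 1) with a^2 = 1, whence theta = 27.  The roots of
    X^2 - X + 1 are the opposites of the primitive cube roots of unity, so it
    is reducible over F_q exactly when 3 divides q - 1, i.e. 6 divides q - 1
    since q is odd. *)

Lemma root_scaled_Phi6 (F : fieldType) (a : F) (h : {poly F}) (x : F) :
  a != 0 -> h = a *: ('X^2 - 'X + 1) -> root h x = (x ^+ 2 - x + 1 == 0).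
Proof. by move=> a0 ->; rewrite rootE !hornerE mulf_eq0 (negPf a0). Qed.

Lemma size_Phi6 (F : fieldType) : size ('X^2 - 'X + 1 : {poly F}) = 3%N.
Proof.
rewrite -addrA size_polyDl size_polyXn //.
by rewrite size_polyDl ?size_polyN ?size_polyX ?size_poly1.
Qed.

Lemma Gpoly_sqr (F : finFieldType) : Gpoly (- 3) 1 = ('X^2 - 'X + 1 : {poly F}) ^+ 2.
Proof.
rewrite /Gpoly -!mul_polyC !(polyCN, polyCM, polyC_natr).
have -> : (1 : F)%:P = 1 by [].
ring.
Qed.

Lemma Gpoly_eq_sqr (F : finFieldType) (s t : F) (h : {poly F}) :
  2 != 0 :> F -> t != 0 -> size h = 3%N -> Gpoly s t = h ^+ 2 ->
  [/\ s = - 3, t = 1 & exists2 a, a != 0 & h = a *: ('X^2 - 'X + 1)].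
Proof.
move=> two_neq0 t_neq0 size_h eqG.
have coefG i := congr1 (fun g : {poly F} => g`_i) eqG.
have h_ge3 i : (2 < i)%N -> h`_i = 0 by move=> i_gt2; rewrite nth_default ?size_h.
move: (coefG 0%N) (coefG 1%N) (coefG 2%N) (coefG 3%N) (coefG 4%N).
rewrite /Gpoly expr2 !coefM !big_ord_recl !big_ord0 /= /bump /= !subn0 ?subnn.
rewrite !coefE /= !addn0 !add1n !subSS !subn0 (h_ge3 3%N) // (h_ge3 4%N) //.
set a := h`_2; set b := h`_1; set c := h`_0 => e0 e1 e2 e3 e4.
(* The padded expressions in the [transitivity] steps below are the coefficients of [Gpoly s t] in
   the exact form they have in [e0] to [e4], so that these equations rewrite. *)
have aa : a * a = 1.
  by transitivity (1 - 2 * 0 - s * 0 - 2 * t * 0 + 0); [rewrite e4|]; ring.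
(* The cubic coefficient gives [2ab = -2]; multiplying [2b] by [a * a = 1] isolates [b]. *)
have eb : b = - a.
  apply: (mulfI two_neq0); transitivity (a * a * (2 * b)).
    by rewrite aa mul1r.
  have -> : a * a * (2 * b) = a * (b * a + a * b) by ring.
  transitivity (a * (0 - 2 * 1 - s * 0 - 2 * t * 0 + 0)); last by ring.
  by rewrite e3; ring.
have et : t = c * a.
  apply: (mulfI two_neq0); transitivity (- (0 - 2 * 0 - s * 0 - 2 * t * 1 + 0)).
    by ring.
  by rewrite e1 eb; ring.
have tcc : t = c * c.
  by transitivity (0 - 2 * 0 - s * 0 - 2 * t * 0 + t); [|rewrite e0]; ring.
(* Combining [t = ca] and [t = c^2] gives [t^2 = c^2 a^2 = c^2 = t], and [t] cancels. *)
have t1 : t = 1.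
  apply: (mulfI t_neq0); rewrite mulr1 {1 2}et.
  have -> : c * a * (c * a) = c * c * (a * a) by ring.
  by rewrite aa mulr1 -tcc.
have ec : c = a by rewrite -[c]mulr1 -aa mulrA -et t1 mul1r.
split=> //.
  transitivity (- (0 - 2 * 0 - s * 1 - 2 * t * 0 + 0)); first by ring.
  rewrite e2 eb ec.
  have -> : - (a * a + (- a * - a + (a * a + 0))) = - 3 * (a * a) by ring.
  by rewrite aa mulr1.
exists a; first by apply: contra_eq_neq aa => ->; rewrite mul0r eq_sym oner_neq0.
apply/polyP => -[|[|[|i]]]; rewrite !coefE /=.
- by rewrite -/c ec; ring.
- by rewrite -/b eb; ring.
- by rewrite -/a; ring.
- by rewrite h_ge3 //; ring.
Qed.

(** Write [#|F| - 1 = 3m]. The polynomial [X^m - 1] has at most [m] roots, fewer than the [3m]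
    nonzero elements, so some [w = x^m] differs from 1. Then [w^3 = 1], and [-w] is the root
    sought. *)
Lemma Phi6_root_of_card (F : finFieldType) :
  (3 %| #|F|.-1)%N -> exists x : F, x ^+ 2 - x + 1 = 0.
Proof.
move=> /dvdnP[m cardF].
have F_gt1 := finNzRing_gt1 F.
have m_gt0 : (0 < m)%N.
  by move: F_gt1 cardF; case: #|F| => [|[|n]] // _; case: m.
have [x x_neq0 xm_neq1] : exists2 x : F, x != 0 & x ^+ m != 1.
  apply/exists_inP; apply: contraTT isT => /exists_inPn xm_eq1.
  have := max_unity_roots (F := F) (n := m) (rs := enum [set~ 0]%SET) m_gt0.
  rewrite enum_uniq -cardE cardsC1 cardF => /(_ _ isT) le_m.
  suff : (m * 3 <= m)%N by lia.
  apply: le_m; apply/allP => x; rewrite mem_enum !inE unity_rootE => /xm_eq1.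
  by rewrite negbK.
exists (- x ^+ m).
have : (x ^+ m) ^+ 3 = 1.
  rewrite -exprM -cardF; apply: (mulfI x_neq0).
  by rewrite -exprS prednK ?expf_card ?mulr1 // ltnW.
(* Cancel [w - 1] in [w^3 - 1 = (w - 1)(w^2 + w + 1)]. *)
move=> w3; apply: (mulfI (x := x ^+ m - 1)); first by rewrite subr_eq0.
by rewrite mulr0; transitivity ((x ^+ m) ^+ 3 - 1); [ring | rewrite w3 subrr].
Qed.

(** Here [w = -x] is a cube root of unity. If [#|F|] were 2 modulo 3, then [w = w^#|F| = w^2] would
    force [w = 1], and [x = -1] is a root only if [3 = 0]. *)
Lemma card_of_Phi6_root (F : finFieldType) (x : F) :
  3 != 0 :> F -> x ^+ 2 - x + 1 = 0 -> (#|F| %% 3 != 2)%N.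
Proof.
move=> three_neq0 x_root; apply/eqP => cardF.
have w3 : (- x) ^+ 3 = 1.
  apply/eqP; rewrite -subr_eq0.
  have -> : (- x) ^+ 3 - 1 = - (x + 1) * (x ^+ 2 - x + 1) by ring.
  by rewrite x_root mulr0.
have := expf_card (- x).
rewrite (divn_eq #|F| 3) cardF exprD mulnC exprM w3 expr1n mul1r => w2.
have w1 : - x = 1.
  apply: (mulfI (x := - x)); last by rewrite mulr1 -[RHS]w2.
  by apply: contra_eq_neq w3 => ->; rewrite expr0n eq_sym oner_neq0.
move: x_root; rewrite -[x]opprK w1 => eq3.
by move: three_neq0; rewrite -eq3 => /eqP; apply; ring.
Qed.

(** Applied with [r] equal to 2 and 3, this leaves only the residues 1 and 5 for [q] modulo 6. *)
Lemma prime_ge5_expn_ndvd (p k r : nat) :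
  prime p -> (5 <= p)%N -> prime r -> (r < 5)%N -> ~~ (r %| p ^ k)%N.
Proof.
move=> p_prime p_ge5 r_prime r_lt5; apply/negP; rewrite Euclid_dvdX // => /andP[].
by rewrite dvdn_prime2 // => /eqP; lia.
Qed.

Theorem theorem6p19 (p k q : nat) (p_prime : prime p) (p_ge5 : (5 <= p)%N)
    (q_def : q = (p ^ k)%N) (F : finFieldType) (cardF : #|F| = q) :
  (q = 1 %[mod 6] -> Theta_c F = set0) /\
  (q <> 1 %[mod 6] -> Theta_c F = [set 27%:R]).
Proof.
have charF : p \in [pchar F] by apply: (card_finPcharP (n := k)); rewrite ?cardF.
have natF_neq0 n : (0 < n < 5)%N -> n%:R != 0 :> F.
  by rewrite -(dvdn_pcharf charF) => n_lt5; apply/negP => /dvdn_leq; lia.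
have theta27 : theta (- 3) 1 = 27 :> F.
  rewrite /theta; have -> : 1 * (1 - 3 + 1) = -1 :> F by ring.
  by rewrite invrN1; ring.
have Omega_neq0 s t : Omega F (s, t) -> t != 0.
  by rewrite /Omega /= mulf_eq0 negb_or => /andP[].
have := prime_ge5_expn_ndvd k p_prime p_ge5; rewrite -q_def => q_ndvd.
move: (q_ndvd 2%N isT isT) (q_ndvd 3%N isT isT) => q_odd q_ndvd3.
split=> [q1 | qN1]; apply/seteqP; split=> // y.
- case=> -[s t] /= [/Omega_neq0 t0 [h [szh [_ irr_h] Gh]]] _.
  have [_ _ [a a0 defh]] := Gpoly_eq_sqr (natF_neq0 2%N isT) t0 szh Gh.
  have [|x x0] := @Phi6_root_of_card F.
    by rewrite cardF; move: q1 q_odd; lia.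
  have : root h x by rewrite (root_scaled_Phi6 _ a0 defh) x0.
  (* A linear factor of the irreducible [h] would be associate to it, but their sizes are 2 and
     3. *)
  rewrite -dvdp_XsubCl => /irr_h; rewrite size_XsubC => /(_ isT)/eqp_size.
  by rewrite size_XsubC szh.
- case=> -[s t] /= [/Omega_neq0 t0 [h [szh _ Gh]]] <-.
  by have [-> -> _] := Gpoly_eq_sqr (natF_neq0 2%N isT) t0 szh Gh.
- move=> ->; exists (- 3, 1) => //=; split.
    rewrite /Omega /=; have -> : 1 * (1 - 3 + 1) = -1 :> F by ring.
    by rewrite oppr_eq0 oner_neq0.
  exists ('X^2 - 'X + 1); split; [exact: size_Phi6 | | exact: Gpoly_sqr].
  (* In degree 2, having no root suffices for irreducibility. *)
  apply: cubic_irreducible => [|x]; first by rewrite size_Phi6.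
  rewrite (root_scaled_Phi6 _ (oner_neq0 F)) ?scale1r //; apply/eqP.
  move=> /(card_of_Phi6_root (natF_neq0 3%N isT)).
  (* Now [q] is 5 modulo 6, hence 2 modulo 3. *)
  by rewrite cardF; move: q_odd q_ndvd3 qN1; lia.
Qed.
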